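(* Let $Z=m_1P_1+\cdots+m_sP_s\subseteq\mathbb{P}^n$ be a set of fat points, and let $m=\max\{m_1,\dots,m_s\}$. If $$0\to\mathbb{F}_{n-1}\to\cdots\to\mathbb{F}_0\to I_Z\to 0$$ is a minimal graded free resolution of $I_Z$ over $R$, then $$\operatorname{rk}\mathbb{F}_{n-1}\ge\binom{m+n-2}{n-1}.$$
   Context: $k$ is an algebraically closed field of characteristic zero, $n\ge 1$, and $R=k[x_0,\dots,x_n]$ with the standard grading, the homogeneous coordinate ring of $\mathbb{P}^n=\mathbb{P}^n_k$. For distinct points $P_1,\dots,P_s\in\mathbb{P}^n$ ($s\geq 1$) and positive integers $m_1,\dots,m_s$, the set of fat points $Z=m_1P_1+\cdots+m_sP_s$ is the scheme defined by $I_Z=I_{P_1}^{m_1}\cap\cdots\cap I_{P_s}^{m_s}$, where $I_{P_j}\subseteq R$ is the homogeneous prime ideal of $P_j$. *)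

(* Defs.v *)
From mathcomp Require Import all_boot all_order all_algebra.
From mathcomp Require Import mpoly.

Set Implicit Arguments.
Unset Strict Implicit.
Unset Printing Implicit Defensive.

Import GRing.Theory.
Local Open Scope ring_scope.

(* Ideals are [Prop]-valued predicates, so that membership needs no decision
   procedure. *)
Section Ideals.
Variable A : comNzRingType.

Definition ideal_gen (G : A -> Prop) (f : A) : Prop :=
  exists (N : nat) (c g : 'I_N -> A),
    (forall i, G (g i)) /\ f = \sum_(i < N) c i * g i.

Definition ideal_pow (I : A -> Prop) (m : nat) : A -> Prop :=
  ideal_gen (fun p =>
    exists g : 'I_m -> A, (forall i, I (g i)) /\ p = \prod_(i < m) g i).

End Ideals.

(* Points of P^n are given by homogeneous coordinate vectors in k^(n+1). *)
Section FatPoints.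
Variables (k : fieldType) (n : nat).

Definition same_point (u v : 'rV[k]_n.+1) : Prop :=
  exists2 c : k, c != 0 & u = c *: v.

Definition point_ideal (u : 'rV[k]_n.+1) : {mpoly k[n.+1]} -> Prop :=
  ideal_gen (fun p => (exists d : nat, p \is d.-homog) /\ p.@[u 0] = 0).

Definition fat_points_ideal (s : nat) (P : 'I_s -> 'rV[k]_n.+1)
    (mult : 'I_s -> nat) (f : {mpoly k[n.+1]}) : Prop :=
  forall j : 'I_s, ideal_pow (point_ideal (P j)) (mult j) f.

End FatPoints.

Section Resolutions.
Variables (k : fieldType) (N : nat).
Local Notation S := {mpoly k[N]}.

Definition irrelevant_ideal : S -> Prop :=
  ideal_gen (fun p => exists i : 'I_N, p = 'X_i).

(* Homogeneity of degree [d] for a possibly negative [d]; the zero polynomial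
   is homogeneous of every degree. *)
Definition homog_int (d : int) (p : S) : Prop :=
  match d with
  | Posz e => p \is e.-homog
  | Negz _ => p = 0
  end.

(* A sequence ... -> F_1 -> F_0 -> S of graded free modules and degree 0 maps.
   F_i is the direct sum of the S(- shift i j) for j < rk i; its elements are
   row vectors, and the maps are multiplication by matrices on the right. *)
Record graded_free_seq := GradedFreeSeq {
  rk : nat -> nat;
  shift : forall i, 'I_(rk i) -> int;
  aug : 'cV[S]_(rk 0);
  diff : forall i, 'M[S]_(rk i.+1, rk i);
  aug_homog : forall a, homog_int (shift a) (aug a 0);
  diff_homog : forall i a b, homog_int (shift a - shift b) (diff i a b)
}.

Definition is_resolution (F : graded_free_seq) (I : S -> Prop) : Prop :=
  [/\ forall f : S, I f <-> exists v : 'rV_(rk F 0), v *m aug F = f%:M,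
      forall v : 'rV_(rk F 0),
        v *m aug F = 0 <-> exists w, v = w *m diff F 0
    & forall i (v : 'rV_(rk F i.+1)),
        v *m diff F i = 0 <-> exists w, v = w *m diff F i.+1].

(* The image of F_(i+1) lies in (x_0, ..., x_(N-1)) F_i. *)
Definition is_minimal (F : graded_free_seq) : Prop :=
  forall i (v : 'rV_(rk F i.+1)) (b : 'I_(rk F i)),
    irrelevant_ideal ((v *m diff F i) 0 b).

(* F_i = 0 for i >= l, so that F reads 0 -> F_(l-1) -> ... -> F_0. *)
Definition vanishes_from (F : graded_free_seq) (l : nat) : Prop :=
  forall i, (l <= i)%N -> rk F i = 0%N.

Definition minimal_graded_free_resolution
    (F : graded_free_seq) (I : S -> Prop) (l : nat) : Prop :=
  [/\ is_resolution F I, is_minimal F & vanishes_from F l].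

End Resolutions.

(* Main.v *)
Require Import Defs.
From mathcomp Require Import all_boot all_order all_algebra.
From mathcomp Require Import mpoly ring.

(* The rank of F_(n-1) can be bounded below after localizing at a point u of
   maximal multiplicity m, where the bound is the dimension of the socle
   I_u^(m-1) / I_u^m of R / I_u^m over the residue field of u. Pick a product h
   of linear forms that is nonzero at u and lies in the ideals of the other fat
   points. The products h * l^e, with l^e a monomial of degree m-1 in n
   independent linear forms l_1, ..., l_n vanishing at u, are killed by the l_i
   modulo I_Z and are independent over R / I_u modulo I_Z. Since l_1, ..., l_n is
   a regular sequence, dimension shifting along the resolution turns them into
   elements of F_(n-1) that are independent modulo I_u, so there are at most
   rk F_(n-1) of them. *)

Set Implicit Arguments.
Unset Strict Implicit.
Unset Printing Implicit Defensive.

Import GRing.Theory.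
Local Open Scope ring_scope.

(** * Linear dependence over a residue domain *)

Section ResidualIndependence.
Variables (A : comNzRingType) (D : idomainType) (phi : {rmorphism A -> D}).

(* A kernel vector over [D] need not lift to [A], so the elimination takes place
   in [A]. *)
Lemma left_dependent_modulo (N r : nat) (g : 'M[A]_(r, N)) : (N < r)%N ->
  exists2 c : 'rV[A]_r, map_mx phi c != 0 & map_mx phi (c *m g) = 0.
Proof.
elim: N r g => [|N IHN] [|r] // g lt_N_r.
  exists (const_mx 1); last by apply/matrixP=> ? [].
  by apply/eqP=> /matrixP/(_ 0 0)/eqP; rewrite !mxE rmorph1 oner_eq0.
have [p nz_p | col0] := pickP (fun p => phi (g p 0) != 0).
  (* Fraction-free elimination of column 0 and row [p] with pivot [g p 0]. A solution [c'] for the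
     minors is scaled by the pivot, and the entry at [p] is chosen to clear column 0. *)
  pose g' := \matrix_(i < r, j < N)
    (g p 0 * g (lift p i) (lift 0 j) - g (lift p i) 0 * g p (lift 0 j)).
  have [c' nz_c' c'g'] := IHN r g' lt_N_r.
  pose c := \row_(i < r.+1)
    if unlift p i is Some i' then g p 0 * c' 0 i'
    else - \sum_(i' < r) c' 0 i' * g (lift p i') 0.
  have cp : c 0 p = - \sum_(i' < r) c' 0 i' * g (lift p i') 0.
    by rewrite mxE unlift_none.
  have cl i : c 0 (lift p i) = g p 0 * c' 0 i by rewrite mxE liftK.
  exists c.
    apply: contra_neq nz_c' => /matrixP c0; apply/matrixP=> i j.
    have /eqP := c0 0 (lift p j).
    rewrite [i]ord1 !mxE liftK rmorphM mulf_eq0 (negPf nz_p) /=.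
    by move/eqP.
  apply/matrixP=> i j; rewrite [i]ord1 !mxE (bigD1_ord p) //= cp.
  have [j' -> | ->] := unliftP 0 j; last first.
    rewrite (_ : _ + _ = 0) ?rmorph0 // mulNr mulrC mulr_sumr addrC.
    by apply/eqP; rewrite subr_eq0; apply/eqP/eq_bigr=> k _; rewrite cl mulrA.
  move/matrixP/(_ 0 j'): c'g'; rewrite !mxE => <-; congr (phi _).
  rewrite mulNr mulr_suml addrC -sumrB; apply: eq_bigr => k _.
  by rewrite cl !mxE mulrBr mulrCA !mulrA.
have [c nz_c c_g] := IHN r.+1 (col' 0 g) (ltnW lt_N_r).
exists c => //; apply/matrixP=> i j; rewrite [i]ord1.
have [j' -> | ->] := unliftP 0 j.
  move/matrixP/(_ 0 j'): c_g; rewrite !mxE => <-; congr (phi _).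
  by apply: eq_bigr => k _; rewrite !mxE.
rewrite !mxE rmorph_sum big1 // => k _.
by rewrite rmorphM (eqP (negbFE (col0 k))) mulr0.
Qed.

End ResidualIndependence.

(** * Dimension shifting along a regular sequence *)

Section Descent.
Variables A B : comNzRingType.

(** Only vectors that lift to [A] are tested, so this is exactness over [A / ker phi], at the terms
    of positive index. *)
Definition exact_modulo (phi : {rmorphism A -> B}) (rk : nat -> nat)
    (d : forall i, 'M[A]_(rk i.+1, rk i)) : Prop :=
  forall i (v : 'rV_(rk i.+1)),
    map_mx phi (v *m d i) = 0
    <-> exists w, map_mx phi v = map_mx phi (w *m d i.+1).

Lemma exact_modulo_mx (phi : {rmorphism A -> B}) rk
    (d : forall i, 'M[A]_(rk i.+1, rk i)) : exact_modulo phi d ->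
  forall i r (v : 'M_(r, rk i.+1)),
    map_mx phi (v *m d i) = 0
    <-> exists w, map_mx phi v = map_mx phi (w *m d i.+1).
Proof.
move=> exd i r v; split=> [vd0 | [w vw]].
  have /fin_all_exists[w vw] : forall a : 'I_r, exists w,
      map_mx phi (row a v) = map_mx phi (w *m d i.+1).
    by move=> a; apply/exd; rewrite -row_mul map_row vd0 row0.
  exists (\matrix_a w a); apply/row_matrixP=> a.
  by rewrite -!map_row vw row_mul rowK.
apply/row_matrixP=> a; rewrite -map_row row_mul row0; apply/exd.
by exists (row a w); rewrite map_row vw -row_mul map_row.
Qed.

(* Each of the regular elements [y j] replaces the module [F_0 / im F_1] by
   [im F_1 / y im F_1], whose resolution is one step shorter; a socle element
   [f] is replaced by [y f], that is, by some [f'] in [F_1] mapping to it. *)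
Lemma socle_descent n (phi : nat -> {rmorphism A -> B}) (y : nat -> A)
    rk (d : forall i, 'M[A]_(rk i.+1, rk i)) r (f : 'M[A]_(r, rk 0%N))
    (Q : 'rV[A]_r -> Prop) :
    (forall j a, (j < n)%N -> phi j (y j * a) = 0 -> phi j a = 0) ->
    (forall j a, (j < n)%N ->
       phi j.+1 a = 0 <-> exists b, phi j a = phi j (y j * b)) ->
    exact_modulo (phi 0%N) d ->
    (forall j, (j < n)%N ->
       exists w, map_mx (phi 0%N) (y j *: f) = map_mx (phi 0%N) (w *m d 0%N)) ->
    (forall c w, map_mx (phi 0%N) (c *m f) = map_mx (phi 0%N) (w *m d 0%N) ->
       Q c) ->
  exists g : 'M[A]_(r, rk n), forall c w,
    map_mx (phi n) (c *m g) = map_mx (phi n) (w *m d n) -> Q c.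
Proof.
elim: n phi y rk d f => [|n IHn] phi y rk d f reg ker exd soc indep.
  by exists f.
have reg_mx p q (M : 'M_(p, q)) :
    map_mx (phi 0%N) (y 0%N *: M) = 0 -> map_mx (phi 0%N) M = 0.
  move=> /matrixP yM0; apply/matrixP=> a b; rewrite !mxE.
  by apply: reg => //; have := yM0 a b; rewrite !mxE.
have ker_mx p q (M : 'M_(p, q)) : map_mx (phi 1%N) M = 0 <->
    exists X, map_mx (phi 0%N) M = map_mx (phi 0%N) (y 0%N *: X).
  split=> [/matrixP M0 | [X /matrixP MX]].
    have /fin_all_exists[X MX] (ab : 'I_p * 'I_q) : exists b,
        phi 0%N (M ab.1 ab.2) = phi 0%N (y 0%N * b).
      by apply/ker => //; have := M0 ab.1 ab.2; rewrite !mxE.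
    by exists (\matrix_(a, b) X (a, b)); apply/matrixP=> a b; rewrite !mxE -MX.
  apply/matrixP=> a b; rewrite !mxE; apply/ker => //; exists (X a b).
  by have := MX a b; rewrite !mxE.
have ker1 p q (M X : 'M_(p, q)) :
    map_mx (phi 0%N) M = map_mx (phi 0%N) X ->
    map_mx (phi 1%N) M = map_mx (phi 1%N) X.
  move=> MX; apply/eqP; rewrite -subr_eq0 -map_mxB; apply/eqP/ker_mx.
  by exists 0; rewrite scaler0 map_mx0 map_mxB MX subrr.
have ker1y p q (X : 'M_(p, q)) : map_mx (phi 1%N) (y 0%N *: X) = 0.
  by apply/ker_mx; exists X.
have dd0 i p (w : 'M_(p, _)) : map_mx (phi 0%N) (w *m d i.+1 *m d i) = 0.
  by apply/(exact_modulo_mx exd); exists w.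
(* Reduction modulo [y 0] keeps the shifted complex exact: if [v d = y X], then [X] is a cycle by
   regularity, so [X = u d], and [v - y u] is a cycle, hence a boundary. *)
have exm i p (v : 'M_(p, _)) X :
    map_mx (phi 0%N) (v *m d i.+1) = map_mx (phi 0%N) (y 0%N *: X) ->
    exists u w,
      map_mx (phi 0%N) v = map_mx (phi 0%N) (w *m d i.+2 + y 0%N *: u).
  move=> vX.
  have /(exact_modulo_mx exd)[u uX] : map_mx (phi 0%N) (X *m d i) = 0.
    apply: reg_mx; rewrite scalemxAl map_mxM -vX -map_mxM; exact: dd0.
  have /(exact_modulo_mx exd)[w vw] :
      map_mx (phi 0%N) ((v - y 0%N *: u) *m d i.+1) = 0.
    rewrite mulmxBl map_mxB vX -scalemxAl !map_mxZ uX; exact: subrr.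
  by exists u, w; rewrite map_mxD -vw -map_mxD subrK.
have [f' f'd] := soc 0%N isT.
have := IHn (fun j => phi j.+1) (fun j => y j.+1) (fun i => rk i.+1)
  (fun i => d i.+1) f'; apply.
- by move=> j a lt_jn; apply: reg.
- by move=> j a lt_jn; apply: ker.
- move=> i v; split=> [/ker_mx[X vX] | [w vw]].
    have [u [w vw]] := exm _ _ _ _ vX; exists w.
    by rewrite (ker1 _ _ _ _ vw) map_mxD ker1y addr0.
  by rewrite map_mxM vw -map_mxM (ker1 _ _ _ 0) ?map_mx0 // dd0.
- move=> j lt_jn; have [g gd] := soc j.+1 lt_jn.
  (* Both terms map under [d 0] to [y 0 * y j.+1] times [f]. By exactness their difference is a
     boundary, so [f'] is again killed by [y j.+1] modulo [y 0]. *)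
  have /(exact_modulo_mx exd)[w gw] :
      map_mx (phi 0%N) ((y j.+1 *: f' - y 0%N *: g) *m d 0%N) = 0.
    rewrite mulmxBl -!scalemxAl map_mxB !map_mxZ -f'd -gd -!map_mxZ !scalerA.
    by rewrite mulrC subrr.
  by exists w; rewrite -(ker1 _ _ _ _ gw) map_mxB ker1y subr0.
(* A relation [c f' = w d_1 + y_0 g] maps under [d 0] to [y_0 c f = y_0 g d_0], where [y_0]
   cancels. *)
move=> c w /eqP; rewrite -subr_eq0 -map_mxB => /eqP/ker_mx[g cg].
have : map_mx (phi 0%N) (c *m f - g *m d 0%N) = 0.
  apply: reg_mx; rewrite scalerBr scalemxAr scalemxAl map_mxB !map_mxM -cg f'd.
  by rewrite -!map_mxM mulmxBl map_mxB dd0 subr0 mulmxA subrr.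
by rewrite map_mxB => /eqP; rewrite subr_eq0 => /eqP; apply: indep.
Qed.

End Descent.

(** * Products in powers of an ideal *)

Section IdealPowers.
Variables (A : comNzRingType) (I : A -> Prop).

Lemma ideal_gen_base (G : A -> Prop) g : G g -> ideal_gen G g.
Proof.
by move=> Gg; exists 1%N, (fun=> 1), (fun=> g); rewrite big_ord1 mul1r.
Qed.

Lemma ideal_gen_mull (G : A -> Prop) a f : ideal_gen G f -> ideal_gen G (a * f).
Proof.
case=> N [c [g [Gg ->]]]; exists N, (fun i => a * c i), g; split=> //.
by rewrite mulr_sumr; apply: eq_bigr => i _; rewrite mulrA.
Qed.

Lemma ideal_pow0 a : ideal_pow I 0 a.
Proof.
rewrite -[a]mulr1; apply/ideal_gen_mull/ideal_gen_base.
by exists (fun=> 0); split=> [[]|]; rewrite ?big_ord0.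
Qed.

Lemma ideal_powS p m q : I p -> ideal_pow I m q -> ideal_pow I m.+1 (p * q).
Proof.
move=> Ip [N [c [g [Ig ->]]]]; exists N, c, (fun i => p * g i).
split=> [i|]; last by rewrite mulr_sumr; apply: eq_bigr => i _; rewrite mulrCA.
have [h [Ih ->]] := Ig i.
exists (fun j => if unlift ord0 j is Some j' then h j' else p); split=> [j|].
  by case: unliftP.
rewrite big_ord_recl unlift_none; congr (_ * _).
by apply: eq_bigr => j _; rewrite liftK.
Qed.

Lemma ideal_powX p e m q :
  I p -> ideal_pow I m q -> ideal_pow I (e + m) (p ^+ e * q).
Proof.
move=> Ip Iq; elim: e => [|e IHe]; first by rewrite mul1r.
by rewrite exprS -mulrA; apply: ideal_powS.
Qed.

Lemma ideal_pow_prodX n (p : 'I_n -> A) (e : 'I_n -> nat) :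
  (forall i, I (p i)) -> ideal_pow I (\sum_i e i) (\prod_i p i ^+ e i).
Proof.
move=> Ip; apply: (big_rec2 (fun d q => ideal_pow I d q)) => [|i d q _ Iq].
  exact: ideal_pow0.
exact: ideal_powX.
Qed.

End IdealPowers.

(** * Order of vanishing at the origin *)

Section MPolyFacts.
Variables (n : nat) (R : comNzRingType).
Implicit Types p q : {mpoly R[n]}.

Lemma mpoly_alg_ind (P : {mpoly R[n]} -> Prop) :
    (forall c, P c%:MP) -> (forall i, P 'X_i) ->
    (forall p q, P p -> P q -> P (p + q)) ->
    (forall p q, P p -> P q -> P (p * q)) ->
  forall p, P p.
Proof.
move=> PC PX PD PM; elim/mpolyind=> [|c m p _ _ Pp]; first by rewrite -mpolyC0.
apply: PD Pp; rewrite -mul_mpolyC; apply: (PM) => //.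
rewrite mpolyXE_id; elim/big_rec: _ => [|i q _ Pq]; first by rewrite -mpolyC1.
apply: (PM _ _ _ Pq); elim: (m i) => [|e IHe]; first by rewrite expr0 -mpolyC1.
by rewrite exprS; apply: (PM).
Qed.

(** Membership in the [d]-th power of the ideal of the variables, read off from coefficients. *)
Definition order_ge d p := forall e : 'X_{1..n}, (mdeg e < d)%N -> p@_e = 0.

Lemma order_geM d d' p q :
  order_ge d p -> order_ge d' q -> order_ge (d + d') (p * q).
Proof.
move=> pd qd e lt_e; rewrite mcoeffM big1 // => -[k l] /eqP/= def_e.
have [/pd-> | le_d] := ltnP (mdeg k) d; first by rewrite mul0r.
rewrite qd ?mulr0 // -(ltn_add2l d); apply: leq_ltn_trans lt_e.
have /esym/eq_leq := congr1 (@mdeg n) def_e; rewrite mdegD.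
by apply: leq_trans; rewrite leq_add2r.
Qed.

Lemma order_ge_sum (J : Type) (r : seq J) (P : pred J) d
    (F : J -> {mpoly R[n]}) :
  (forall i, P i -> order_ge d (F i)) -> order_ge d (\sum_(i <- r | P i) F i).
Proof.
move=> Fd e lt_e; rewrite raddf_sum big1 //= => i Pi.
exact: Fd.
Qed.

Lemma order_ge_prod d (F : 'I_d -> {mpoly R[n]}) :
  (forall i, (F i)@_0%MM = 0) -> order_ge d (\prod_i F i).
Proof.
elim: d F => [|d IHd] F F0 //; rewrite big_ord_recl.
apply: (@order_geM 1); last exact: IHd.
by move=> e; rewrite ltnS leqn0 mdeg_eq0 => /eqP->.
Qed.

Lemma order_geX e : order_ge (mdeg e) 'X_[e].
Proof.
by move=> e' lt_e; rewrite mcoeffX; case: eqP lt_e => // ->; rewrite ltnn.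
Qed.

(** Without its constant term, [p] has order at least 1, which pushes the product beyond the degree
    of [e']. *)
Lemma mcoeff_mulX p e e' : mdeg e = mdeg e' ->
  (p * 'X_[e])@_e' = p@_0%MM * (e == e')%:R.
Proof.
move=> eq_deg; rewrite -{1}[p](subrK (p@_0%MM)%:MP) mulrDl mcoeffD mcoeffCM.
rewrite mcoeffX.
rewrite (_ : (_ * _)@_e' = 0) ?add0r //.
apply: (@order_geM 1 (mdeg e)); last by rewrite eq_deg add1n.
  move=> f; rewrite ltnS leqn0 mdeg_eq0 => /eqP->.
  by rewrite mcoeffB mcoeffC eqxx mulr1 subrr.
exact: order_geX.
Qed.

End MPolyFacts.

(** * Linear coordinates adapted to a point *)

Section Chart.
Variables (k : fieldType) (n : nat) (u : 'rV[k]_n.+1) (i0 : 'I_n.+1).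
Hypothesis u_i0 : u 0 i0 != 0.
Local Notation S := {mpoly k[n.+1]}.

(* [along] and the [transv i] are linear coordinates in which [u] becomes
   [(1, 0, ..., 0)]; the [transv i] generate the prime ideal of [u]. *)
Definition along : S := (u 0 i0)^-1 *: 'X_i0.
Definition transv (i : 'I_n) : S := 'X_(lift i0 i) - u 0 (lift i0 i) *: along.

Lemma mpolyX_coord i :
  'X_i = u 0 i *: along + oapp transv 0 (unlift i0 i).
Proof.
case: unliftP => [j | ] -> /=; first by rewrite addrC subrK.
by rewrite addr0 scalerA divff ?scale1r.
Qed.

Section ChartFacts.
Variables (T : comNzRingType) (iota : {rmorphism S -> T}) (z : 'I_n -> T).

(** [along] and the [transv i] are free generators of [S] over [k], so the values on the [transv i]
    can be prescribed. Both the reductions modulo the [transv i] and the expansion in powers of them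
    arise in this way. *)
Lemma chart_subproof : {F : {rmorphism S -> T} |
  [/\ forall c, F c%:MP = iota c%:MP, F along = iota along
    & forall i, F (transv i) = z i]}.
Proof.
pose F : {rmorphism S -> T} := mmap (iota \o @mpolyC n.+1 k)
  (fun i => iota (u 0 i *: along) + oapp z 0 (unlift i0 i)).
have FC c : F c%:MP = iota c%:MP by exact: mmapC.
have FX i : F 'X_i = iota (u 0 i *: along) + oapp z 0 (unlift i0 i).
  by rewrite /F /= mmapX mmap1U.
have Fa : F along = iota along.
  rewrite {1}/along -mul_mpolyC rmorphM FC FX unlift_none addr0 -rmorphM.
  by rewrite mul_mpolyC scalerA mulVf ?scale1r.
exists F; split=> // i; rewrite /transv rmorphB FX liftK -mul_mpolyC !rmorphM.
by rewrite FC Fa addrC addKr.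
Qed.

Definition chart : {rmorphism S -> T} := sval chart_subproof.

Lemma chartC c : chart c%:MP = iota c%:MP.
Proof. by case: (svalP chart_subproof) => ->. Qed.

Lemma chart_along : chart along = iota along.
Proof. by case: (svalP chart_subproof). Qed.

Lemma chart_transv i : chart (transv i) = z i.
Proof. by case: (svalP chart_subproof). Qed.

Lemma chartX i : chart 'X_i = iota (u 0 i *: along) + oapp z 0 (unlift i0 i).
Proof.
rewrite {1}mpolyX_coord -mul_mpolyC rmorphD !rmorphM chartC chart_along.
by case: unlift => [i'|] /=; rewrite ?chart_transv ?rmorph0.
Qed.

Lemma chart_unique (F : {rmorphism S -> T}) :
    (forall c, F c%:MP = iota c%:MP) -> F along = iota along ->
    (forall i, F (transv i) = z i) ->
  F =1 chart.
Proof.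
move=> FC Fa Ft; elim/mpoly_alg_ind=> [c | i | p q Fp Fq | p q Fp Fq].
- by rewrite chartC.
- rewrite chartX {1}mpolyX_coord -mul_mpolyC rmorphD !rmorphM FC Fa.
  by case: unlift => [i'|] /=; rewrite ?Ft ?rmorph0.
- by rewrite !rmorphD Fp Fq.
by rewrite !rmorphM Fp Fq.
Qed.

End ChartFacts.

(* Reduction modulo the [transv i] with [i < j], as an idempotent endomorphism,
   so that all these residue rings live in [S]. *)
Definition kill_transv (j : nat) : {rmorphism S -> S} :=
  chart idfun (fun i => if (i < j)%N then 0 else transv i).

Lemma kill_transvC j c : kill_transv j c%:MP = c%:MP.
Proof. exact: chartC. Qed.

Lemma kill_transv_along j : kill_transv j along = along.
Proof. exact: chart_along. Qed.

Lemma kill_transv_id j (i : 'I_n) :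
  kill_transv j (transv i) = if (i < j)%N then 0 else transv i.
Proof. exact: chart_transv. Qed.

Lemma kill_transvX j i : kill_transv j 'X_i = u 0 i *: along +
  oapp (fun i' : 'I_n => if (i' < j)%N then 0 else transv i') 0 (unlift i0 i).
Proof. exact: chartX. Qed.

Lemma kill_transv0 p : kill_transv 0 p = p.
Proof. by rewrite /kill_transv -(@chart_unique _ _ _ idfun). Qed.

Lemma kill_transvK l j p : (l <= j)%N ->
  kill_transv j (kill_transv l p) = kill_transv j p.
Proof.
move=> le_lj; pose F : {rmorphism S -> S} := kill_transv j \o kill_transv l.
have FE q : F q = kill_transv j (kill_transv l q) by [].
rewrite -FE; apply: chart_unique => [c | | i]; rewrite FE.
- by rewrite (kill_transvC l) kill_transvC.
- by rewrite (kill_transv_along l) kill_transv_along.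
rewrite (kill_transv_id l); case: ltnP => [lt_il|_].
  by rewrite rmorph0 (leq_trans lt_il le_lj).
exact: kill_transv_id.
Qed.

(** The two reductions differ only in the value at [transv i]; divisibility of the difference passes
    from generators to sums and products. *)
Lemma kill_transvS (i : 'I_n) p :
  exists b, kill_transv i p = kill_transv i.+1 p + transv i * b.
Proof.
elim/mpoly_alg_ind: p => [c | l | p q [b pb] [c qc] | p q [b pb] [c qc]].
- by exists 0; rewrite !kill_transvC mulr0 addr0.
- rewrite !kill_transvX; case: unliftP => [l' | ] _ /=; last first.
    by exists 0; rewrite mulr0 !addr0.
  rewrite ltnS; have [_|_|/val_inj->] := ltngtP l' i.
  + by exists 0; rewrite mulr0 !addr0.
  + by exists 0; rewrite mulr0 addr0.
  by exists 1; rewrite mulr1 !addr0.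
- by exists (b + c); rewrite !rmorphD pb qc mulrDr addrACA.
exists (b * kill_transv i q + kill_transv i.+1 p * c).
by rewrite !rmorphM pb qc; ring.
Qed.

Lemma transv_neq0 i : transv i != 0.
Proof.
apply/eqP=> /(congr1 (mcoeff U_(lift i0 i))).
rewrite mcoeff0 mcoeffB !mcoeffZ !mcoeffXU eqxx (negPf (neq_lift _ _)).
by rewrite !mulr0 subr0 => /eqP; rewrite oner_eq0.
Qed.

(** This reduction fixes [transv i], which is nonzero in the domain [S]; with [kill_transv_ker] this
    makes the [transv i] a regular sequence. *)
Lemma kill_transv_reg (i : 'I_n) a :
  kill_transv i (transv i * a) = 0 -> kill_transv i a = 0.
Proof.
rewrite rmorphM kill_transv_id // ltnn => /eqP.
by rewrite mulf_eq0 (negPf (transv_neq0 _)) => /eqP.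
Qed.

Lemma kill_transv_ker (i : 'I_n) a : kill_transv i.+1 a = 0 <->
  exists b, kill_transv i a = kill_transv i (transv i * b).
Proof.
split=> [a0 | [b ab]].
  have [b ab] := kill_transvS i a; exists b.
  by rewrite -[LHS](kill_transvK _ (leqnn i)) ab a0 add0r.
rewrite -(kill_transvK _ (leqnSn i)) ab kill_transvK // rmorphM.
by rewrite kill_transv_id // ltnSn mul0r.
Qed.

(** Killing every [transv i] restricts [p] to the line spanned by [u]: each variable becomes its
    coordinate in [u] times [along]. *)
Lemma kill_transv_homog d p : p \is d.-homog ->
  kill_transv n p = p.@[u 0] *: along ^+ d.
Proof.
move=> /dhomogP hom_p; rewrite mevalE scaler_suml {1}[p]mpolyE rmorph_sum /=.
rewrite big_seq [RHS]big_seq; apply: eq_bigr => e supp_e.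
have deg_e : mdeg e = d by apply: hom_p.
rewrite -mul_mpolyC rmorphM kill_transvC mul_mpolyC -scalerA; congr (_ *: _).
rewrite mpolyXE_id rmorph_prod -deg_e mdegE -prodrXr -scaler_prod.
apply: eq_bigr => i _; rewrite rmorphXn /= kill_transvX -exprZn.
by case: unliftP => [i' | ] _ /=; rewrite ?ltn_ord addr0.
Qed.

Lemma kill_transv_eq0 d p : p \is d.-homog ->
  (kill_transv n p == 0) = (p.@[u 0] == 0).
Proof.
move=> hom_p; rewrite (kill_transv_homog hom_p) scaler_eq0 expf_eq0.
suff -> : along == 0 = false by rewrite andbF orbF.
apply/eqP=> /(congr1 (mcoeff U_(i0))); rewrite mcoeff0 mcoeffZ mcoeffXU eqxx.
by rewrite mulr1 => /eqP; rewrite invr_eq0 (negPf u_i0).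
Qed.

Lemma point_ideal_kill p : point_ideal u p -> kill_transv n p = 0.
Proof.
case=> N [c [g [Ig ->]]]; rewrite rmorph_sum big1 // => i _.
have [[d hom_g] g0] := Ig i; apply/eqP.
by rewrite rmorphM mulf_eq0 (kill_transv_eq0 hom_g) g0 eqxx orbT.
Qed.

Lemma mpolyX_homog i : ('X_i : S) \is 1.-homog.
Proof. by rewrite dhomogX; apply/eqP/mdeg1. Qed.

Lemma point_ideal_transv i : point_ideal u (transv i).
Proof.
apply: ideal_gen_base; split.
  by exists 1%N; rewrite rpredB ?rpredZ // mpolyX_homog.
by rewrite mevalB !mevalZ !mevalXU mulVf ?mulr1 ?subrr.
Qed.

(** The Taylor expansion in directions transverse to the line of [u], with coefficients polynomial
    in [along]. It turns powers of the ideal of [u] into orders of vanishing. *)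
Definition normal_expansion : {rmorphism S -> {mpoly S[n]}} :=
  chart (@mpolyC n S) (fun i => 'X_i).

Lemma normal_expansion0 p : (normal_expansion p)@_0%MM = kill_transv n p.
Proof.
apply: (@chart_unique _ _ _ (mcoeff 0%MM \o normal_expansion)) p => [c||i] /=.
- by rewrite chartC mcoeffC eqxx mulr1.
- by rewrite chart_along mcoeffC eqxx mulr1.
by rewrite chart_transv mcoeffX ltn_ord -mdeg_eq0 mdeg1.
Qed.

Lemma order_point_ideal_pow m p :
  ideal_pow (point_ideal u) m p -> order_ge m (normal_expansion p).
Proof.
case=> N [c [g [Ig ->]]]; rewrite rmorph_sum; apply: order_ge_sum => i _.
have [h [Ih ->]] := Ig i; rewrite rmorphM rmorph_prod.
apply: (@order_geM _ _ 0) => //.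
by apply: order_ge_prod => j; rewrite normal_expansion0 point_ideal_kill.
Qed.

Definition transv_monomial (e : 'X_{1..n}) : S := \prod_i transv i ^+ e i.

Lemma normal_expansion_monomial e :
  normal_expansion (transv_monomial e) = 'X_[e].
Proof.
rewrite rmorph_prod mpolyXE_id; apply: eq_bigr => i _.
by rewrite rmorphXn /= chart_transv.
Qed.

Lemma ideal_pow_transv_monomial e :
  ideal_pow (point_ideal u) (mdeg e) (transv_monomial e).
Proof. by rewrite mdegE; apply: ideal_pow_prodX; apply: point_ideal_transv. Qed.

(** In degree [m] of the expansion, the coefficient at [e b] is the constant term of the expansion
    of [a b], and it must vanish. *)
Lemma transv_monomial_indep (J : finType) (e : J -> 'X_{1..n}) m (a : J -> S) :
    injective e -> (forall b, mdeg (e b) = m) ->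
    ideal_pow (point_ideal u) m.+1 (\sum_b a b * transv_monomial (e b)) ->
  forall b, kill_transv n (a b) = 0.
Proof.
move=> inj_e deg_e /order_point_ideal_pow a_e b.
have := a_e (e b); rewrite deg_e ltnSn rmorph_sum raddf_sum /= => /(_ isT).
rewrite (bigD1 b) //= rmorphM normal_expansion_monomial mcoeff_mulX //.
rewrite eqxx mulr1 normal_expansion0 big1 ?addr0 // => b' ne_b'.
rewrite rmorphM normal_expansion_monomial mcoeff_mulX ?deg_e //.
by rewrite (inj_eq inj_e) (negPf ne_b') mulr0.
Qed.

End Chart.

(** * Separating points by linear forms, and counting monomials *)

Lemma separating_linear_form (k : fieldType) (n : nat) (u v : 'rV[k]_n.+1) :
    u != 0 -> v != 0 -> ~ same_point u v ->
  exists q : {mpoly k[n.+1]},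
    [/\ q \is 1.-homog, q.@[v 0] = 0 & q.@[u 0] != 0].
Proof.
move=> nz_u nz_v nuv.
have [i nz_vi] : exists i, v 0 i != 0 by apply/rV0Pn.
(* These forms cut out the point [v]: if all vanish at [u], then [u] is [u 0 i / v 0 i] times
   [v]. *)
pose q j : {mpoly k[n.+1]} := v 0 i *: 'X_j - v 0 j *: 'X_i.
have qE j w : (q j).@[w] = v 0 i * w j - v 0 j * w i.
  by rewrite mevalB !mevalZ !mevalXU.
have [j nz_q | q0] := pickP (fun j => (q j).@[u 0] != 0).
  exists (q j); split=> //; last by rewrite qE mulrC subrr.
  by rewrite rpredB ?rpredZ ?mpolyX_homog.
have u_v : u = (u 0 i / v 0 i) *: v.
  apply/rowP=> j; rewrite mxE; have /negbFE := q0 j.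
  by rewrite qE subr_eq0 => /eqP vu; apply: (mulfI nz_vi); rewrite vu; field.
case: nuv; exists (u 0 i / v 0 i) => //.
by apply: contra_neq nz_u => c0; rewrite u_v c0 scale0r.
Qed.

Lemma multinoms_of_degree n d : exists e : 'I_('C(n + d, n)) -> 'X_{1..n.+1},
  injective e /\ forall i, mdeg (e i) = d.
Proof.
(* Exponents in degree [d] are at most [d], so tuples over ['I_d.+1] capture all the monomials. *)
pose D := [set t : n.+1.-tuple 'I_d.+1 | (\sum_(i <- t) i == d)%N].
have cardD : 'C(n + d, n) = #|D| by rewrite card_ord_partitions.
pose t i := enum_val (cast_ord cardD i).
exists (fun i => [multinom (tnth (t i) l : nat) | l < n.+1]).
split=> [i i' eq_e | i].
  apply/(@cast_ord_inj _ _ cardD)/enum_val_inj/eq_from_tnth => l; apply/val_inj.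
  by have := congr1 (fun x : 'X_{1..n.+1} => x l) eq_e; rewrite !mnmE.
have := enum_valP (cast_ord cardD i); rewrite inE big_tuple => /eqP.
apply: etrans.
by rewrite mdegE; apply: eq_bigr => l _; rewrite mnmE.
Qed.

(** * The resolution of the quotient ring *)

Section Augmented.
Variables (k : fieldType) (N : nat) (F : graded_free_seq k N).
Local Notation S := {mpoly k[N]}.

(** With [S] placed at index 0, the complex resolves the quotient by the ideal, and the term [i] of
    [F] moves to index [i.+1]. *)
Definition augmented_rk i := if i is i'.+1 then rk F i' else 1%N.

Definition augmented_diff i : 'M[S]_(augmented_rk i.+1, augmented_rk i) :=
  match i return 'M[S]_(augmented_rk i.+1, augmented_rk i) with
  | 0%N => aug F
  | i'.+1 => diff F i'
  end.

(** Stated for a pointwise identity because the descent starts from [kill_transv 0]. *)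
Lemma augmented_exact (phi : {rmorphism S -> S}) I : (forall p, phi p = p) ->
  is_resolution F I -> exact_modulo phi augmented_diff.
Proof.
move=> phiE [_ ex0 exS].
have mapE p q (M : 'M_(p, q)) : map_mx phi M = M.
  by apply/matrixP=> i j; rewrite mxE phiE.
have imE p (u : 'rV[S]_p) q (M : 'M_(q, p)) :
    (exists w, u = w *m M) <-> (exists w, map_mx phi u = map_mx phi (w *m M)).
  by split=> -[w uw]; exists w; move: uw; rewrite !mapE.
move=> [|i] v; rewrite mapE; first exact: iff_trans (ex0 v) (imE _ _ _ _).
exact: iff_trans (exS i v) (imE _ _ _ _).
Qed.

End Augmented.

(** * Isolating one fat point *)

Section FatPointsIdeal.
Variables (k : fieldType) (n s : nat) (P : 'I_s -> 'rV[k]_n.+1).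
Hypothesis P_neq0 : forall j, P j != 0.
Hypothesis P_distinct : forall i j, same_point (P i) (P j) -> i = j.
Variables (mult : 'I_s -> nat) (j0 : 'I_s) (i0 : 'I_n.+1).
Hypothesis P_i0 : P j0 0 i0 != 0.

(** Multiplication by [h], a unit in the local ring at [P j0], takes the place of localization
    there. *)
Lemma isolate_point : exists h : {mpoly k[n.+1]},
  kill_transv P_i0 n h != 0 /\
  forall p, ideal_pow (point_ideal (P j0)) (mult j0) p ->
    fat_points_ideal P mult (h * p).
Proof.
(* The condition sits under the existential so that a form can be chosen for every [j], with default
   0 at [j0]. *)
have sep j : exists q : {mpoly k[n.+1]}, j != j0 ->
    [/\ q \is 1.-homog, q.@[P j 0] = 0 & q.@[P j0 0] != 0].
  have [-> | ne_j] := eqVneq j j0; first by exists 0.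
  have nPj : ~ same_point (P j0) (P j).
    by move/P_distinct=> eq_j; rewrite eq_j eqxx in ne_j.
  have [q Pq] := separating_linear_form (P_neq0 j0) (P_neq0 j) nPj.
  by exists q.
have /fin_all_exists[q Pq] := sep.
exists (\prod_(j | j != j0) q j ^+ mult j); split.
  rewrite rmorph_prod; apply/prodf_neq0 => j /Pq[hom_q _ nz_q].
  by rewrite rmorphXn expf_neq0 // (kill_transv_eq0 _ hom_q).
move=> p Ip j; have [-> | ne_j] := eqVneq j j0; first exact: ideal_gen_mull.
rewrite (bigD1 j) //= -mulrA -[X in ideal_pow _ X]addn0; apply: ideal_powX.
  have [hom_q q0 _] := Pq j ne_j.
  by apply: ideal_gen_base; split=> //; exists 1%N.
exact: ideal_pow0.
Qed.

End FatPointsIdeal.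

(** * The rank bound *)

Theorem corollary5p9 (k : closedFieldType) (char0 : [pchar k] =i pred0)
    (n : nat) (n_ge1 : (1 <= n)%N) (s : nat) (s_ge1 : (1 <= s)%N)
    (P : 'I_s -> 'rV[k]_n.+1) (P_neq0 : forall j, P j != 0)
    (P_distinct : forall i j, same_point (P i) (P j) -> i = j)
    (mult : 'I_s -> nat) (mult_gt0 : forall j, (0 < mult j)%N)
    (m : nat) (m_max : m = (\max_(j < s) mult j)%N)
    (F : graded_free_seq k n.+1)
    (F_res : minimal_graded_free_resolution F (fat_points_ideal P mult) n) :
  ('C(m + n - 2, n - 1) <= rk F (n - 1))%N.
Proof.
have [res_F _ _] := F_res; have [I_F _ _] := res_F.
have [j0 max_j0] : {j0 | (\max_(j < s) mult j)%N = mult j0}.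
  by apply: eq_bigmax; rewrite card_ord.
have [i0 P_i0] : exists i0, P j0 0 i0 != 0 by apply/rV0Pn.
have [h [nz_h I_h]] := isolate_point P_neq0 P_distinct mult P_i0.
(* From here the dimension is [n.+1] and the maximal multiplicity is [d.+1], so the bound counts the
   monomials of degree [d] in [n.+1] variables. *)
case: n n_ge1 P P_neq0 P_distinct F F_res res_F I_F i0 P_i0 h nz_h I_h
  => // n _ P _ _ F _ res_F I_F i0 P_i0 h nz_h I_h.
have := mult_gt0 j0; rewrite m_max max_j0.
case def_m : (mult j0) => [|d] // _; rewrite def_m in I_h.
have -> : (d.+1 + n.+1 - 2 = n + d)%N.
  by rewrite addnC !addSn addnS !subSS subn0.
rewrite subn1 /= leqNgt; apply/negP=> lt_rk.
have [e [inj_e deg_e]] := multinoms_of_degree n d.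
pose phi := kill_transv P_i0.
(* The descent takes a sequence indexed by [nat]; beyond [n] the value is 0. *)
pose y j : {mpoly k[n.+2]} := oapp (transv (P j0) i0) 0 (insub j).
have yE (i : 'I_n.+1) : y i = transv (P j0) i0 i by rewrite /y valK.
pose f : 'cV_('C(n + d, n)) := \col_a (h * transv_monomial (P j0) i0 (e a)).
pose Q (c : 'rV_('C(n + d, n))) := forall a, phi n.+1 (c 0 a) = 0.
have phi0 p q (M : 'M_(p, q)) : map_mx (phi 0%N) M = M.
  by apply/matrixP=> i j; rewrite mxE /phi kill_transv0.
(* Starting from index 0 of the augmented complex, [n.+1] descents end in the term [n] of [F]. *)
have [|||||g indep_g] :=
  @socle_descent _ _ n.+1 phi y _ (augmented_diff F) _ f Q.
- by move=> j a lt_j; rewrite (yE (Ordinal lt_j));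
  exact: (@kill_transv_reg _ _ _ _ P_i0 (Ordinal lt_j)).
- by move=> j a lt_j; rewrite (yE (Ordinal lt_j));
  exact: (kill_transv_ker P_i0 (Ordinal lt_j)).
- by apply: augmented_exact res_F => p; apply: kill_transv0.
(* One more transverse factor puts the monomial in the power [d.+1] of the ideal of [P j0], and [h]
   handles the other points. *)
- move=> j lt_j; rewrite (yE (Ordinal lt_j)).
  have /fin_all_exists[w w_aug] (a : 'I_('C(n + d, n))) : exists w,
      w *m aug F = (transv (P j0) i0 (Ordinal lt_j) * f a 0)%:M.
    apply/I_F; rewrite mxE mulrCA; apply: I_h; apply: ideal_powS.
      exact: point_ideal_transv.
    by rewrite -(deg_e a); apply: ideal_pow_transv_monomial.
  exists (\matrix_a w a); rewrite !phi0; apply/row_matrixP=> a.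
  rewrite row_mul rowK w_aug; apply/matrixP=> i l.
  by rewrite [i]ord1 [l]ord1 !mxE.
(* A combination in the fat points ideal lies in the power [d.+1] at [P j0], so each [c 0 a * h]
   reduces to 0, and [h] cancels in the domain. *)
- move=> c w; rewrite !phi0 => cf a.
  have I_cf : fat_points_ideal P mult ((c *m f) 0 0).
    apply/I_F; exists w.
    by rewrite -[LHS]/(w *m augmented_diff F 0) -cf [LHS]mx11_scalar.
  have := I_cf j0; rewrite def_m mxE.
  under eq_bigr do rewrite mxE mulrA.
  move/(transv_monomial_indep P_i0 inj_e deg_e)/(_ a)/eqP.
  by rewrite rmorphM mulf_eq0 (negPf nz_h) orbF => /eqP.
(* Too small a rank forces a relation among the rows of [g] that is nontrivial after reduction;
   independence with [w = 0] excludes it. *)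
have [c nz_c cg0] := left_dependent_modulo (phi n.+1) g lt_rk.
case/eqP: nz_c; apply/rowP=> a; rewrite !mxE; apply: (indep_g c 0).
by rewrite cg0 mul0mx map_mx0.
Qed.
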